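(* Let $d:\mathbb{N}\to\mathbb{N}$ be a function with $d(n)^3\log n/n\to 0$ as $n\to\infty$. Then there is a function $\eta:\mathbb{N}\to[0,\infty)$ with $\eta(n)\to 0$ as $n\to\infty$ such that for every $n$ (for which $d(n)$-regular graphs on $n$ vertices exist), every $d$-regular graph $G$ on $n$ vertices, where $d=d(n)$, contains a spanning subgraph $H$ such that for every integer $k$ with $0\le k\le d$, $$\left|m(H,k)-\frac{n}{d+1}\right|\le \eta(n)\,\frac{n}{d+1}.$$
   Context: All graphs are finite and simple (no loops, no parallel edges). For a graph $G$ and an integer $k\ge 0$, $m(G,k)$ denotes the number of vertices of degree exactly $k$ in $G$, and $m(G)=\max_k m(G,k)$. A spanning subgraph of $G$ is a subgraph with the same vertex set as $G$. *)

(* Defs.v *)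
From mathcomp Require Import all_boot.
From Stdlib Require Import Reals.

Set Implicit Arguments.
Unset Strict Implicit.
Unset Printing Implicit Defensive.

Definition simple_graph (T : finType) (e : rel T) : Prop :=
  (forall x y, e x y = e y x) /\ (forall x, e x x = false).

Definition deg (T : finType) (e : rel T) (x : T) : nat := #|[set y | e x y]|.

Definition regular (T : finType) (e : rel T) (k : nat) : Prop :=
  forall x, deg e x = k.

Definition spanning_subgraph (T : finType) (h g : rel T) : Prop :=
  simple_graph h /\ (forall x y, h x y -> g x y).

Definition mdeg (T : finType) (e : rel T) (k : nat) : nat :=
  #|[set x | deg e x == k]|.

(* Main.v *)
Require Import Defs.
From mathcomp Require Import all_boot.
From mathcomp Require Import perm zify.
From Stdlib Require Import Reals Lra.

(** Give every vertex an independent uniform weight [x v] in [{0..M}], [M] huge,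
and keep the edge [uv] when [x u + x v > M].  Relative to [u], the degree of [u]
is the rank of [x u] among the values [M - x w] of its neighbours [w].
Exchanging [x u] with [M - x w] preserves the measure, cycles the role of [u]
through its closed neighbourhood, and changes the degree of any other vertex [v]
by at most 2, and not at all if [v] is at distance more than 2.  Hence
P(deg u = deg v) is at most about 1/(d+1) for distant pairs and O(1/(d+1)) for
the O(d^2) close ones, so the second moment of the degree counts exceeds
n^2/(d+1) by O(n(d+1)) only.  Some outcome therefore has all the deviations
|m(H,k) - n/(d+1)| at most sqrt(14 n (d+1)), which is o(n/(d+1)) as soon as
d^3 = o(n). *)

(** * Degree counts as sums over vertices and pairs *)

Lemma card_set_sum (T : finType) (P : pred T) : #|[set x | P x]| = \sum_x P x.
Proof. by rewrite -sum1_card big_mkcond; apply: eq_bigr => x _; rewrite inE; case: (P x). Qed.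

Lemma sum_by_degree (V : finType) (h : rel V) d (F : nat -> nat) :
  (forall u, deg h u <= d) ->
  \sum_u F (deg h u) = \sum_(k < d.+1) mdeg h k * F k.
Proof.
move=> hd; pose f u : 'I_d.+1 := inord (deg h u).
have fE u k : (f u == k) = (deg h u == k) by rewrite -val_eqE /= inordK // ltnS.
rewrite (partition_big f predT) //=; apply: eq_bigr => k _.
under eq_bigl => u do rewrite fE.
under eq_bigr => u /eqP-> do [].
by rewrite sum_nat_const /mdeg cardsE.
Qed.

Lemma sum_mdeg (V : finType) (h : rel V) d : (forall u, deg h u <= d) ->
  \sum_(k < d.+1) mdeg h k = #|V|.
Proof.
move=> hd; have := @sum_by_degree V h d (fun=> 1) hd; rewrite sum1_card => ->.
by apply: eq_bigr => k _; rewrite muln1.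
Qed.

(** Turns the second moment of the degree counts into a count of pairs, which can be averaged pair
    by pair. *)
Lemma sum_mdeg_sqr (V : finType) (h : rel V) d : (forall u, deg h u <= d) ->
  \sum_(u : V) \sum_(v : V) (deg h u == deg h v) =
  \sum_(k < d.+1) mdeg h k * mdeg h k.
Proof.
move=> hd; rewrite -(@sum_by_degree V h d (mdeg h) hd); apply: eq_bigr => u _.
by rewrite /mdeg card_set_sum; apply: eq_bigr => v _; rewrite eq_sym.
Qed.

(** * The subgraph cut out by vertex weights *)

Section WeightedSubgraph.

Variables (V : finType) (e : rel V).
Hypothesis e_sym : forall x y, e x y = e y x.
Hypothesis e_irr : forall x, e x x = false.
Variables (d M : nat).
Hypothesis e_reg : forall x, deg e x = d.

Local Notation weight := {ffun V -> 'I_M.+1}.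
Implicit Types (x : weight) (u v w : V).

(** [rev_ord a] is [M - a], so the test says [x u + x v > M]. *)
Definition weight_graph x : rel V :=
  fun u v => e u v && (rev_ord (x v) < x u).

Definition nbhd u : {set V} := u |: [set v | e u v].

Lemma weight_graph_spanning x : spanning_subgraph (weight_graph x) e.
Proof.
split; first split=> [u v|u]; rewrite /weight_graph.
- by rewrite e_sym; congr (_ && _); rewrite /=; move: (ltn_ord (x u)) (ltn_ord (x v)); lia.
- by rewrite e_irr.
- by move=> u v /andP[].
Qed.

Lemma card_nbhd u : #|nbhd u| = d.+1.
Proof. by rewrite cardsU1 inE e_irr -(e_reg u). Qed.

Lemma deg_weight_graph x u :
  deg (weight_graph x) u = \sum_(j | e u j) (rev_ord (x j) < x u).
Proof.
rewrite /deg card_set_sum [RHS]big_mkcond /=.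
by apply: eq_bigr => j _; rewrite /weight_graph; case: (e u j).
Qed.

Lemma deg_weight_graph_le x u : deg (weight_graph x) u <= d.
Proof.
rewrite -(e_reg u); apply: subset_leq_card; apply/subsetP => j.
by rewrite !inE => /andP[].
Qed.

(** * Ranks in a closed neighbourhood, and the swap *)

(** The values seen from [u]: its own weight, and for a neighbour [j] the threshold that this weight
    must exceed to keep the edge. *)
Definition side x u j : 'I_M.+1 := if j == u then x u else rev_ord (x j).

Definition rank x u i : nat :=
  \sum_(j in nbhd u) (side x u j < side x u i).

(** The transposition of [u] and [w] acting on the values [side x u], translated back into
    weights. *)
Definition swap u w x : weight :=
  [ffun j => if j == u then side x u (tperm u w j)
             else rev_ord (side x u (tperm u w j))].

Lemma side_swap u w x j : side (swap u w x) u j = side x u (tperm u w j).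
Proof. by rewrite /side !ffunE eqxx; case: (altP (j =P u)) => [->|_] //=; rewrite rev_ordK. Qed.

Lemma swapK u w : involutive (swap u w).
Proof.
move=> x; apply/ffunP=> j; rewrite ffunE side_swap tpermK /side.
by case: eqP => [->|_] //; rewrite rev_ordK.
Qed.

Lemma swap_out u w x j : j != u -> j != w -> swap u w x j = x j.
Proof.
move=> ju jw; rewrite ffunE (negbTE ju) tpermD 1?eq_sym //.
by rewrite /side (negbTE ju) rev_ordK.
Qed.

Lemma deg_rank x u : deg (weight_graph x) u = rank x u u.
Proof.
rewrite deg_weight_graph /rank big_mkcond [RHS]big_mkcond /=.
apply: eq_bigr => j _; rewrite !inE /side eqxx.
by case: eqP => [->|_] /=; rewrite ?e_irr ?ltnn.
Qed.

Lemma rank_swap x u w : w \in nbhd u -> rank (swap u w x) u u = rank x u w.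
Proof.
move=> wu; rewrite /rank [RHS](reindex_inj (@perm_inj _ (tperm u w))) /=.
have uu : u \in nbhd u by rewrite !inE eqxx.
by apply: eq_big => [j|j _]; [case: tpermP => [->|->|]; rewrite ?wu ?uu | rewrite !side_swap tpermL].
Qed.

(** Rules out ties in [side x u] for all [u] at once. *)
Definition generic x : bool :=
  [forall p : V * V, (p.1 != p.2) ==>
    (x p.1 != x p.2) && (x p.1 != rev_ord (x p.2))].

Lemma generic_side_inj x u : generic x -> injective (side x u).
Proof.
move=> /forallP g i j; rewrite /side.
case: (altP (i =P u)) => [->|iu]; case: (altP (j =P u)) => [->|ju] //.
- by move=> E; have := g (u, j); rewrite /= eq_sym ju E eqxx /= andbF.
- by move=> E; have := g (u, i); rewrite /= eq_sym iu E eqxx /= andbF.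
- move/rev_ord_inj => E; apply/eqP; case: (altP (i =P j)) => // ij.
  by have := g (i, j); rewrite /= ij E eqxx.
Qed.

Lemma rank_lt x u i j : i \in nbhd u ->
  side x u i < side x u j -> rank x u i < rank x u j.
Proof.
move=> iu ij; rewrite /rank [X in X < _](bigD1 i) // [X in _ < X](bigD1 i) //=.
rewrite ltnn ij add0n add1n ltnS; apply: leq_sum => k _.
by case: (ltnP (side x u k) (side x u i)) => // /ltn_trans/(_ ij) ->.
Qed.

Lemma rank_inj x u : generic x -> {in nbhd u &, injective (rank x u)}.
Proof.
move=> g i j iu ju E; apply: (generic_side_inj x u g); apply/val_inj/eqP.
rewrite eqn_leq leqNgt [X in _ && X]leqNgt.
by apply/andP; split; apply/negP => h; [have := rank_lt x u j i ju h | have := rank_lt x u i j iu h];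
   rewrite E ltnn.
Qed.

Definition close (c a b : nat) : bool := (a <= b + c) && (b <= a + c).

Lemma card_close_rank x u (A : {set V}) c t : generic x -> A \subset nbhd u ->
  \sum_(w in A) close c (rank x u w) t <= c.*2.+1.
Proof.
move=> g /subsetP sA; set B := [set w in A | close c (rank x u w) t].
have -> : \sum_(w in A) close c (rank x u w) t = #|B|.
  rewrite card_set_sum big_mkcond; apply: eq_bigr => w _; by case: (w \in A).
(* If [t < c], truncation makes the window start at 0, and it still reaches [t + c]. *)
rewrite cardE -(size_map (rank x u)) -(size_iota (t - c) c.*2.+1).
apply: uniq_leq_size.
  rewrite map_inj_in_uniq ?enum_uniq // => i j; rewrite !mem_enum !inE.
  by move=> /andP[iA _] /andP[jA _]; apply: rank_inj => //; apply: sA.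
move=> k /mapP[w]; rewrite mem_enum inE => /andP[_ /andP[h1 h2]] ->.
rewrite mem_iota; lia.
Qed.

(** * Degree coincidences for near and far pairs *)

(** Counts out of [#|{: weight}|] play the role of probabilities. *)
Definition ties : nat := #|[set x | ~~ generic x]|.
Definition coincidences u v : nat :=
  #|[set x | deg (weight_graph x) u == deg (weight_graph x) v]|.

(* Composing with [swap u w] turns the degree of [u] into the rank of [w], so
   the coincidence events indexed by [w in A] are equiprobable and, up to ties,
   at most [2c+1] of them hold at the same time. *)
Lemma coincidences_bound u v (A : {set V}) c : A \subset nbhd u ->
  (forall w x, w \in A ->
     close c (deg (weight_graph (swap u w x)) v) (deg (weight_graph x) v)) ->
  #|A| * coincidences u v <= c.*2.+1 * #|{: weight}| + #|A| * ties.
Proof.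
move=> sA hc.
have -> : #|A| * coincidences u v = \sum_(w in A) \sum_x
    (deg (weight_graph (swap u w x)) u == deg (weight_graph (swap u w x)) v).
  rewrite -sum_nat_const; apply: eq_bigr => w _.
  by rewrite /coincidences card_set_sum (reindex_inj (inv_inj (swapK u w))).
rewrite exchange_big /=.
have -> : c.*2.+1 * #|{: weight}| + #|A| * ties =
    \sum_(x : weight) (c.*2.+1 + #|A| * ~~ generic x).
  rewrite big_split /= sum_nat_const mulnC; congr (_ + _).
  by rewrite -big_distrr /ties card_set_sum.
apply: leq_sum => x _; case: (boolP (generic x)) => g.
  rewrite muln0 addn0; apply: leq_trans (card_close_rank x u A c (deg (weight_graph x) v) g sA).
  apply: leq_sum => w wA; rewrite deg_rank (rank_swap _ _ _ (subsetP sA _ wA)).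
  case: eqP => // E; rewrite E; by rewrite (hc w x wA).
rewrite muln1 -sum1_card; apply: leq_trans (leq_addl _ _).
by apply: leq_sum => w _; case: (_ == _).
Qed.

(** Only the terms [j = u] and [j = w] in the degree of [v] can differ, each by at most 1. *)
Lemma deg_weight_graph_out x x' u w v : v != u -> v != w ->
  (forall j, j != u -> j != w -> x j = x' j) ->
  deg (weight_graph x) v <= deg (weight_graph x') v + 2.
Proof.
move=> vu vw h; rewrite !deg_weight_graph h //.
have -> : 2 = \sum_j ((j == u) + (j == w)).
  by rewrite big_split /= -!big_mkcond /= !big_pred1_eq.
rewrite [X in X <= _]big_mkcond [X in _ <= X + _]big_mkcond -big_split /=.
apply: leq_sum => j _; case: (e v j) => //.
case: (altP (j =P u)) => [_|ju] /=; first by case: (_ < _) => //; lia.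
case: (altP (j =P w)) => [_|jw] /=; first by case: (_ < _) => //; lia.
by rewrite h // !addn0.
Qed.

(** Taking [v] out of [nbhd u] keeps [x v] fixed under the swaps, so the degree of [v] moves by at
    most 2, whence [5 = 2 * 2 + 1]. The set left has [d] or [d+1] elements. *)
Lemma coincidences_near u v : u != v ->
  d * coincidences u v <= 5 * #|{: weight}| + d.+1 * ties.
Proof.
move=> uv; have cA : d <= #|nbhd u :\ v| <= d.+1.
  by have := cardsD1 v (nbhd u); rewrite card_nbhd; case: (v \in _) => /=; lia.
have := @coincidences_bound u v (nbhd u :\ v) 2 (subsetDl _ _).
case/andP: cA => c1 c2 H; apply: leq_trans (leq_trans (H _) _).
- by rewrite leq_mul2r c1 orbT.
- move=> w x; rewrite !inE => /andP[wv _]; apply/andP; split;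
    apply: (@deg_weight_graph_out _ _ u w); rewrite 1?eq_sym // => j ju jw;
    by rewrite swap_out.
- by rewrite leq_add2l leq_mul2r c2 orbT.
Qed.

(** The swap leaves all weights on [nbhd v] alone, so the degree of [v] is unchanged and [c = 0]
    applies. *)
Lemma coincidences_far u v : [disjoint nbhd u & nbhd v] ->
  d.+1 * coincidences u v <= #|{: weight}| + d.+1 * ties.
Proof.
move=> dis; have := @coincidences_bound u v (nbhd u) 0 (subxx _).
rewrite card_nbhd mul1n; apply => w x wu.
suff -> : deg (weight_graph (swap u w x)) v = deg (weight_graph x) v.
  by rewrite /close addn0 leqnn.
have uu : u \in nbhd u by rewrite !inE eqxx.
have out j : j \in nbhd v -> swap u w x j = x j.
  move=> jv; apply: swap_out; apply: contraTneq jv => ->;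
  by rewrite (disjointFr dis).
rewrite !deg_weight_graph; apply: eq_bigr => j evj.
by rewrite !out // !inE ?evj ?eqxx ?orbT.
Qed.

Lemma coincidences_le u v : coincidences u v <= #|{: weight}|.
Proof. exact: max_card. Qed.

(** * Ties are rare *)

Lemma card_determined u w (f : 'I_M.+1 -> 'I_M.+1) : u != w ->
  #|[set x : weight | x u == f (x w)]| * M.+1 <= #|{: weight}|.
Proof.
move=> uw; set S := [set x | _].
(* Overwriting the value at [u] loses nothing on [S], since it is recovered from [x w]. *)
pose F (p : weight * 'I_M.+1) : weight := [ffun j => if j == u then p.2 else p.1 j].
rewrite -[X in _ * X]card_ord -cardsT -cardsX.
rewrite -(@card_in_imset _ _ F); first exact: max_card.
move=> [x a] [y b] /setXP[/= xS _] /setXP[/= yS _] /ffunP E.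
have ab : a = b by have := E u; rewrite !ffunE eqxx.
have xy j : j != u -> x j = y j by move=> ju; have := E j; rewrite !ffunE (negbTE ju).
congr (_, _) => //; apply/ffunP => j; case: (altP (j =P u)) => [->|/xy//].
by move: xS yS; rewrite !inE => /eqP-> /eqP->; rewrite xy // eq_sym.
Qed.

(** Union bound over ordered pairs, with two events of probability at most [1/(M+1)] for each. *)
Lemma ties_bound : ties * M.+1 <= 2 * (#|V| * #|V|) * #|{: weight}|.
Proof.
have : ties <= \sum_(p : V * V | p.1 != p.2)
   (#|[set x : weight | x p.1 == x p.2]| + #|[set x : weight | x p.1 == rev_ord (x p.2)]|).
  rewrite /ties; apply: leq_trans (_ : _ <= #|\bigcup_(p : V * V | p.1 != p.2)
     ([set x : weight | x p.1 == x p.2] :|: [set x : weight | x p.1 == rev_ord (x p.2)])|) _.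
    apply: subset_leq_card; apply/subsetP => x; rewrite inE negb_forall => /existsP[p].
    rewrite negb_imply => /andP[pp h]; apply/bigcupP; exists p => //.
    by move: h; rewrite !inE negb_and !negbK.
  apply: (big_rec2 (fun (A : {set weight}) k => #|A| <= k)) => [|p A k _ hA]; first by rewrite cards0.
  apply: leq_trans (leq_card_setU _ _).1 _; rewrite leq_add //; exact: (leq_card_setU _ _).1.
move=> h; apply: leq_trans (leq_mul h (leqnn M.+1)) _.
rewrite big_distrl /=.
apply: leq_trans (_ : _ <= \sum_(p : V * V) 2 * #|{: weight}|) _.
  rewrite big_mkcond; apply: leq_sum => p _; case: ifP => // pp.
  rewrite mulnDl mul2n -addnn; apply: leq_add; [exact: (card_determined _ _ (fun i => i) pp) | exact: card_determined].
by rewrite sum_nat_const card_prod mulnCA mulnA.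
Qed.

(** * Averaging over all pairs and weights *)

Lemma nbhd_sym u v : (u \in nbhd v) = (v \in nbhd u).
Proof. by rewrite !inE eq_sym e_sym. Qed.

(** There are [d+1] choices for a common point [w] and then [d+1] for [v]. *)
Lemma near_count u : \sum_v ~~ [disjoint nbhd u & nbhd v] <= d.+1 * d.+1.
Proof.
apply: leq_trans (_ : _ <= \sum_v \sum_(w in nbhd u) (w \in nbhd v)) _.
  apply: leq_sum => v _; case: (boolP [disjoint _ & _]) => //=.
  rewrite disjoint_subset => /subsetPn[w wu]; rewrite !inE negbK => wv.
  by rewrite (bigD1 w) //= !inE wv.
rewrite exchange_big /=.
under eq_bigr => w _.
  under eq_bigr => v _ do rewrite nbhd_sym.
  rewrite -card_set_sum cardsE card_nbhd; over.
by rewrite sum_nat_const card_nbhd.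
Qed.

(** Far, near and equal pairs in one summable inequality. The near bound is doubled because
    [d+1 <= 2d] for [d > 0]; for [d = 0] the trivial bound suffices. *)
Lemma coincidences_pair u v : d.+1 * coincidences u v <=
  #|{: weight}| + d.+1 * ties
  + ~~ [disjoint nbhd u & nbhd v] * (10 * #|{: weight}| + 2 * (d.+1 * ties))
  + (u == v) * (d.+1 * #|{: weight}|).
Proof.
case: (altP (u =P v)) => [<-|uv].
  by rewrite mul1n; apply: leq_trans (leq_addl _ _); rewrite leq_mul2l coincidences_le.
rewrite mul0n addn0; case: (boolP [disjoint _ & _]) => [/coincidences_far|_] /=.
  by rewrite mul0n addn0.
rewrite mul1n; have := coincidences_near _ _ uv; have := coincidences_le u v.
move: (coincidences u v) #|{: weight}| ties => a K t.
by case: d => [|D]; nia.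
Qed.

(** The 14 is 10 + 2 from near pairs, using [d.+1 * ties <= #|{: weight}|], plus 1 from ties and 1
    from the diagonal. *)
Lemma sum_coincidences : d < #|V| -> #|V| * ties <= #|{: weight}| ->
  \sum_u \sum_v d.+1 * coincidences u v <=
    (#|V| * #|V| + 14 * #|V| * (d.+1 * d.+1)) * #|{: weight}|.
Proof.
move=> dV hT.
apply: leq_trans (_ : _ <= \sum_(u : V) (#|V| + 14 * (d.+1 * d.+1)) * #|{: weight}|) _; last first.
  rewrite sum_nat_const -[#|xpredT|]/#|V|; move: #|V| #|{: weight}| d.+1 => n K D; lia.
apply: leq_sum => u _.
apply: leq_trans (leq_sum _ (fun v _ => coincidences_pair u v)) _.
have h3 : #|V| * (d.+1 * ties) <= d.+1 * #|{: weight}| by rewrite mulnCA leq_mul2l hT orbT.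
have dT : d.+1 * ties <= #|{: weight}| by apply: leq_trans hT; rewrite leq_mul2r dV orbT.
move: (d.+1 * ties) h3 dT => DT h3 dT.
rewrite !big_split /= -!big_distrl /= !sum_nat_const -[#|xpredT|]/#|V|.
have -> : \sum_v (u == v) = 1.
  by under eq_bigr => v _ do rewrite eq_sym; rewrite -big_mkcond big_pred1_eq.
have := near_count u; move: (\sum_v _) => c hc.
move: #|{: weight}| dT #|V| h3 => K dT n h3.
have h1 : c * (10 * K + 2 * DT) <= d.+1 * d.+1 * (12 * K) by apply: leq_mul => //; lia.
have h2 : d.+1 * K <= d.+1 * d.+1 * K by rewrite leq_mul2r leq_pmull ?orbT.
move: h1 h2 h3; move: (d.+1 * d.+1) d.+1 => D2 D; lia.
Qed.

Lemma deg_lt_card : 0 < #|V| -> d < #|V|.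
Proof. by move=> /card_gt0P[u _]; rewrite -(card_nbhd u) max_card. Qed.

Lemma exists_weight : 0 < #|V| -> M = 2 * #|V| * #|V| * #|V| ->
  exists x, \sum_(u : V) \sum_(v : V)
      d.+1 * (deg (weight_graph x) u == deg (weight_graph x) v)
    <= #|V| * #|V| + 14 * #|V| * (d.+1 * d.+1).
Proof.
move=> V0 hM.
have hT : #|V| * ties <= #|{: weight}|.
  have := ties_bound; move: #|{: weight}| ties => K t.
  rewrite hM; move: #|V| V0 => n V0 tb.
  (* With [M = 2n^3], cancelling the factor [2n^2] of the tie bound leaves the claim. *)
  by rewrite -(@leq_pmul2l (2 * (n * n))) ?muln_gt0 ?V0 //; apply: leq_trans tb; lia.
(* If every outcome exceeded the bound, so would the average. *)
apply/existsP; apply: contraT; rewrite negb_exists => /forallP h.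
have := sum_coincidences (deg_lt_card V0) hT.
under eq_bigr => u _ do under eq_bigr => v _ do
  rewrite /coincidences card_set_sum big_distrr.
under eq_bigr => u _ do rewrite exchange_big.
rewrite exchange_big /= leqNgt => /negP[].
set B := #|V| * #|V| + _ in h *.
have -> : B * #|{: weight}| = \sum_(x : weight) B by rewrite sum_nat_const mulnC.
(* Some weight must exist for the summed inequality to be strict. *)
have [x0 _] : exists x0 : weight, true by exists [ffun=> ord0].
rewrite [X in X < _](bigD1 x0) // [X in _ < X](bigD1 x0) //= -addSn leq_add //; first by rewrite ltnNge h.
by apply: leq_sum => x _; rewrite ltnW // ltnNge h.
Qed.

End WeightedSubgraph.

(** * From pair counts to each degree count *)

(** With [D = d+1], the inequality is [(D m - n)^2 <= 14 n D^3], expanded to avoid subtraction. Even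
    the sum of these squares over all degrees obeys the bound. *)
Lemma balanced_subgraph (V : finType) (e : rel V) d :
  simple_graph e -> regular e d ->
  exists h : rel V, spanning_subgraph h e /\ forall k, k <= d ->
    (d.+1 * mdeg h k) * (d.+1 * mdeg h k) + #|V| * #|V| <=
    2 * (d.+1 * mdeg h k) * #|V| + 14 * #|V| * (d.+1 * d.+1 * d.+1).
Proof.
move=> [es ei] er; case: (posnP #|V|) => [V0|V0].
  exists e; split=> // k _.
  have -> : mdeg e k = 0 by apply/eqP; rewrite -leqn0 -V0 max_card.
  by rewrite V0 !muln0.
have [x] := @exists_weight V e es ei d _ er V0 erefl.
set h := weight_graph V e _ x => hx; exists h; split; first exact: weight_graph_spanning.
have hd u : deg h u <= d by exact: deg_weight_graph_le.
move=> k kd; pose i0 : 'I_d.+1 := Ordinal (kd : k < d.+1).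
have s1 := @sum_mdeg V h d hd.
have s2 : d.+1 * \sum_(k < d.+1) mdeg h k * mdeg h k <=
   #|V| * #|V| + 14 * #|V| * (d.+1 * d.+1).
  rewrite -sum_mdeg_sqr // big_distrr; apply: leq_trans hx.
  by apply: leq_sum => u _; rewrite big_distrr.
move: s1 s2; rewrite (bigD1 i0) //= [X in _ * X <= _](bigD1 i0) //=.
set S1 := \sum_(j | _) _; set S2 := \sum_(j | _) _ => s1 s2.
(* The squares [(D m_j - n)^2] of the [d] other degrees are nonnegative. *)
have cs : 2 * d.+1 * #|V| * S1 <= d.+1 * d.+1 * S2 + d * (#|V| * #|V|).
  have <- : \sum_(j < d.+1 | j != i0) #|V| * #|V| = d * (#|V| * #|V|).
    by rewrite sum_nat_const cardC1 card_ord.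
  rewrite !big_distrr -big_split /=; apply: leq_sum => j _.
  have := (nat_Cauchy (d.+1 * mdeg h j) #|V|).1; rewrite !expnS !expn0.
  move: (mdeg h j) #|V| => a n; lia.
have s3 := leq_mul (leqnn d.+1) s2.
move: s1 cs s3; move: (mdeg h k) #|V| => m n s1.
have -> : S1 = n - m by lia.
have : m <= n by lia.
move=> mn; have [p ->] : exists p, n = m + p by exists (n - m); lia.
rewrite addKn; lia.
Qed.

(** * Real estimates and convergence *)

Section RealBounds.

Local Open Scope R_scope.

(** The hypothesis is [(D m - n)^2 <= 14 n D^3]; divide by [D^2] and take roots. *)
Lemma discrepancy_bound (m n D : R) : 0 < n -> 0 < D ->
  (D * m) * (D * m) + n * n <= 2 * (D * m) * n + 14 * n * (D * D * D) ->
  Rabs (m - n / D) <= sqrt (14 * (D * D * D) / n) * (n / D).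
Proof.
move=> n0 D0 h; have nD : 0 < n / D by apply: Rdiv_lt_0_compat.
rewrite -[X in _ * X]sqrt_Rsqr; last lra.
rewrite -sqrt_mult_alt; last first.
  by apply: Rmult_le_pos; [nra | apply/Rlt_le/Rinv_0_lt_compat].
rewrite -sqrt_Rsqr_abs; apply: sqrt_le_1_alt; rewrite /Rsqr.
have -> : 14 * (D * D * D) / n * (n / D * (n / D)) =
  (14 * n * (D * D * D)) * / (D * D) by field; lra.
have -> : (m - n / D) * (m - n / D) = ((D * m - n) * (D * m - n)) * / (D * D).
  by field; lra.
apply: Rmult_le_compat_r; last lra.
by apply/Rlt_le/Rinv_0_lt_compat; nra.
Qed.

(** For [n >= 3], [ln n >= 1], so [d^3 / n] tends to 0, and [(d+1)^3 <= 4 (d^3 + 1)]. *)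
Lemma cubic_ratio_cvg (d : nat -> nat) :
  Un_cv (fun n : nat => INR (d n) ^ 3 * ln (INR n) / INR n) 0 ->
  Un_cv (fun n : nat => sqrt (14 * (INR (d n).+1 * INR (d n).+1 * INR (d n).+1) / INR n)) 0.
Proof.
move=> hd eps eps0.
(* Chosen so that [14 * 4 * (del + del) = eps^2 / 2]. *)
pose del := eps * eps / 224.
have del0 : del > 0 by rewrite /del; nra.
have [N1 h1] := hd del del0.
have [N2 [h2 N20]] := archimed_cor1 del del0.
exists (N1 + N2 + 3)%coq_nat => n hn.
have hn1 : (n >= N1)%coq_nat by lia.
have n3 : 3 <= INR n by rewrite (_ : 3 = INR 3); [apply: le_INR; lia | rewrite /=; lra].
have ln1 : 1 <= ln (INR n).
  rewrite -(ln_exp 1); case: (Rle_lt_or_eq_dec 3 (INR n) n3) => [?|<-];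
    have := exp_le_3 => e3.
    by apply/Rlt_le/ln_increasing; [exact: exp_pos | lra].
  by case: e3 => [e3|->]; [apply/Rlt_le/ln_increasing; [exact: exp_pos | lra] | lra].
have inv : / INR n < del.
  apply: Rle_lt_trans h2; apply: Rinv_le_contravar; first by apply: lt_0_INR; lia.
  by apply: le_INR; lia.
have := h1 n hn1; rewrite /R_dist /Rdiv !Rminus_0_r => h.
have {}h := Rle_lt_trans _ _ _ (Rle_abs _) h.
rewrite Rabs_pos_eq; last exact: sqrt_pos.
rewrite -(sqrt_square eps); last lra.
have i0 : 0 < / INR n by apply: Rinv_0_lt_compat; lra.
apply: sqrt_lt_1_alt; rewrite S_INR; have := pos_INR (d n); move: (INR (d n)) h => a h a0.
(* The difference is [3 (a+1) (a-1)^2]. *)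
have cube : (a + 1) * (a + 1) * (a + 1) <= 4 * (a ^ 3 + 1).
  have := Rmult_le_pos (a + 1) ((a - 1) * (a - 1)) ltac:(lra) (Rle_0_sqr (a - 1)); rewrite /=; nra.
have a3 : 0 <= a ^ 3 by apply: pow_le.
have le1 : a ^ 3 <= a ^ 3 * ln (INR n) by nra.
move: (a ^ 3) a3 le1 cube h => b b0 le1 cube h.
split.
  by apply: Rmult_le_pos; [nra | lra].
have : b * / INR n <= b * ln (INR n) * / INR n by apply: Rmult_le_compat_r; lra.
have : (a + 1) * (a + 1) * (a + 1) * / INR n <= 4 * (b + 1) * / INR n.
  by apply: Rmult_le_compat_r; lra.
rewrite /del in inv h; lra.
Qed.

End RealBounds.

Theorem theorem1p3 (d : nat -> nat) :
  Un_cv (fun n : nat => (INR (d n) ^ 3 * ln (INR n) / INR n)%R) 0%R ->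
  exists eta : nat -> R,
    (forall n, (0 <= eta n)%R) /\ Un_cv eta 0%R /\
    forall (n : nat) (G : rel 'I_n),
      simple_graph G -> regular G (d n) ->
      exists H : rel 'I_n,
        spanning_subgraph H G /\
        forall k : nat, (k <= d n)%N ->
          (Rabs (INR (mdeg H k) - INR n / INR (d n).+1)
             <= eta n * (INR n / INR (d n).+1))%R.
Proof.
move=> hd.
exists (fun n => sqrt (14 * (INR (d n).+1 * INR (d n).+1 * INR (d n).+1) / INR n)%R).
split; first by move=> n; exact: sqrt_pos.
split; first exact: cubic_ratio_cvg.
move=> n G sG rG; have [H [sH hH]] := @balanced_subgraph _ G (d n) sG rG.
exists H; split=> // k /hH; rewrite card_ord.
(* For [n = 0] both sides vanish; [discrepancy_bound] asks for [n > 0]. *)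
have [n0 _|n0] := posnP n.
  have -> : mdeg H k = 0 by apply/eqP; rewrite -leqn0 -[X in _ <= X]n0 -{2}(card_ord n) max_card.
  by rewrite n0 /Rdiv Rmult_0_l Rminus_0_r Rabs_R0 Rmult_0_r; apply: Rle_refl.
move/leP/le_INR => h; apply: discrepancy_bound.
- by apply: lt_0_INR; apply/ltP.
- exact: lt_0_INR (Nat.lt_0_succ _).
move: h; rewrite !(plus_INR, mult_INR).
rewrite !S_INR [INR 0]/=; lra.
Qed.
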